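(* Each lasso solution, for varying parameter, forms a simple polygonal chain in $\mathbb R^p$ with $\hat\beta$ and the origin as the endpoints. There are no two segments of the polygonal chain that are parallel. Each segment of this polygonal chain belongs to one of the rays of the original lasso problem or to one of the rays of the induced lasso problems of a face of a smaller dimension.
   Context: Let $p\ge2$. A data set consists of $N$ points $(x_1^{(i)},\dots,x_p^{(i)},y^{(i)})\in\mathbb R^{p+1}$ with centroid at the origin and not contained in any proper affine subspace (full rank assumption). Put $K_1=\frac1N\sum_i x^{(i)}(x^{(i)})^T$ ($p\times p$, positive definite), $b=\frac1N\sum_i y^{(i)}x^{(i)}\in\mathbb R^p$, $\hat\beta=K_1^{-1}b$, $\hat t=\sum_j|\hat\beta_j|$. For $t\ge0$ the lasso estimate $\beta(t)$ is the unique minimizer of $\frac12\sum_i\big(y^{(i)}-\sum_j\beta_jx_j^{(i)}\big)^2$ over $\beta\in\mathbb R^p$ with $\sum_j|\beta_j|\le t$. The lasso solution is the curve $t\mapsto\beta(t)$, $0\le t\le\hat t$. Its segments (of positive length) are the maximal portions along which the sign vector $(\operatorname{sgn}\beta_1,\dots,\operatorname{sgn}\beta_p)\in\{-1,0,1\}^p$ is constant. For a nonempty $A\subset\{1,\dots,p\}$ let $K_A$ and $b_A$ be the submatrix of $K_1$ and the subvector of $b$ with indices in $A$. The induced lasso problem on the coordinate subspace $\{\beta_j=0,\ j\notin A\}$ is the lasso problem with matrix $K_A$ and vector $b_A$ (minimize $\langle K_A\gamma,\gamma\rangle-2\langle b_A,\gamma\rangle$ subject to $\|\gamma\|_1\le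 t$); $A=\{1,\dots,p\}$ gives the original problem. Its rays are the sets $\{\beta:\ \beta_A=K_A^{-1}b_A+sK_A^{-1}\delta_A,\ s\le0,\ \beta_j=0\text{ for }j\notin A\}$ with $\delta_A\in\{-1,1\}^A$, having the center $K_A^{-1}b_A$ of the corresponding ellipsoids as initial point. *)

(* Defs.v *)
From HB Require Import structures.
From mathcomp Require Import all_boot all_order all_algebra.
From mathcomp Require Import all_classical reals topology normedtype.
Import Order.TTheory GRing.Theory Num.Theory.
Import numFieldNormedType.Exports.
Set Implicit Arguments.
Unset Strict Implicit.
Unset Printing Implicit Defensive.
Local Open Scope classical_set_scope.
Local Open Scope ring_scope.

(* A data set is given by x : 'I_N -> 'cV[R]_p and y : 'I_N -> R; vectors of
   R^p are columns. *)

Definition data_point (R : realType) (p N : nat)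
    (x : 'I_N -> 'cV[R]_p) (y : 'I_N -> R) (i : 'I_N) : 'cV[R]_(p + 1) :=
  col_mx (x i) (y i)%:M.

Definition centroid (R : realType) (p N : nat)
    (x : 'I_N -> 'cV[R]_p) (y : 'I_N -> R) : 'cV[R]_(p + 1) :=
  N%:R^-1 *: \sum_(i < N) data_point x y i.

(* A proper affine subspace is a translate c + V of a proper linear subspace. *)
Definition full_rank_data (R : realType) (p N : nat)
    (x : 'I_N -> 'cV[R]_p) (y : 'I_N -> R) : Prop :=
  ~ exists (c : 'cV[R]_(p + 1)) (V : {vspace 'cV[R]_(p + 1)}),
      V != fullv /\ forall i, data_point x y i - c \in V.

Definition gram (R : realType) (p N : nat) (x : 'I_N -> 'cV[R]_p) : 'M[R]_p :=
  N%:R^-1 *: \sum_(i < N) x i *m (x i)^T.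

Definition covec (R : realType) (p N : nat)
    (x : 'I_N -> 'cV[R]_p) (y : 'I_N -> R) : 'cV[R]_p :=
  N%:R^-1 *: \sum_(i < N) y i *: x i.

Definition l1norm (R : realType) (p : nat) (b : 'cV[R]_p) : R :=
  \sum_(j < p) `|b j 0|.

Definition beta_hat (R : realType) (p N : nat)
    (x : 'I_N -> 'cV[R]_p) (y : 'I_N -> R) : 'cV[R]_p :=
  invmx (gram x) *m covec x y.

Definition t_hat (R : realType) (p N : nat)
    (x : 'I_N -> 'cV[R]_p) (y : 'I_N -> R) : R :=
  l1norm (beta_hat x y).

Definition lasso_objective (R : realType) (p N : nat)
    (x : 'I_N -> 'cV[R]_p) (y : 'I_N -> R) (b : 'cV[R]_p) : R :=
  2^-1 * \sum_(i < N) (y i - \sum_(j < p) b j 0 * x i j 0) ^+ 2.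

Definition unique_lasso_minimizer (R : realType) (p N : nat)
    (x : 'I_N -> 'cV[R]_p) (y : 'I_N -> R) (t : R) (b : 'cV[R]_p) : Prop :=
  l1norm b <= t /\
  forall g : 'cV[R]_p, l1norm g <= t -> g <> b ->
    lasso_objective x y b < lasso_objective x y g.

(* The default value 0 is only taken when there is no unique minimizer, which
   does not happen for full rank data and t >= 0. *)
Definition lasso (R : realType) (p N : nat)
    (x : 'I_N -> 'cV[R]_p) (y : 'I_N -> R) (t : R) : 'cV[R]_p :=
  xget 0 [set b | unique_lasso_minimizer x y t b].

Definition sign_vector (R : realType) (p : nat) (b : 'cV[R]_p) : 'cV[R]_p :=
  map_mx Num.sg b.

Definition sign_constant_portion (R : realType) (p N : nat)
    (x : 'I_N -> 'cV[R]_p) (y : 'I_N -> R) (I : set R) : Prop :=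
  [/\ is_interval I,
      I `<=` `[0, t_hat x y] &
      forall s t, I s -> I t ->
        sign_vector (lasso x y s) = sign_vector (lasso x y t)].

(* A segment is represented by its parameter interval I, as a subset of
   [0, t_hat]; it is the set of points lasso x y @` I. Depending on the sign
   vectors at the end points of I, I may be closed, half-open or open. *)
Definition lasso_segment (R : realType) (p N : nat)
    (x : 'I_N -> 'cV[R]_p) (y : 'I_N -> R) (I : set R) : Prop :=
  [/\ sign_constant_portion x y I,
      exists s t, [/\ I s, I t & s < t] &
      forall J, sign_constant_portion x y J -> I `<=` J -> J = I].

(* The chain has the vertices c a, c ts_0, ..., c ts_(n-1) where n = size ts;
   n = 0 is the chain reduced to one point. *)
Definition chain_pieces (R : realType) (a : R) (ts : seq R) : set (set R) :=
  [set `[(a :: ts)`_k, ts`_k]%classic | k in `I_(size ts)].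

Definition affine_on (R : realType) (p : nat) (c : R -> 'cV[R]_p)
    (I : set R) : Prop :=
  forall s t u, I s -> I t -> 0 <= u <= 1 ->
    c ((1 - u) * s + u * t) = (1 - u) *: c s + u *: c t.

Definition simple_polygonal_chain (R : realType) (p : nat)
    (c : R -> 'cV[R]_p) (a b : R) (ts : seq R) : Prop :=
  [/\ path <%R a ts,
      last a ts = b,
      forall I, chain_pieces a ts I -> affine_on c I &
      {in `[a, b] &, injective c}].

(* Meant for line segments of positive length; lying on a common line
   counts as being parallel. *)
Definition parallel (R : realType) (p : nat) (S T : set 'cV[R]_p) : Prop :=
  exists d : 'cV[R]_p,
    [/\ d != 0,
        forall u v, S u -> S v -> exists c : R, v - u = c *: d &
        forall u v, T u -> T v -> exists c : R, v - u = c *: d].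

Definition sub_vec (R : realType) (p : nat) (A : {set 'I_p})
    (b : 'cV[R]_p) : 'cV[R]_#|A| :=
  \col_k b (enum_val k) 0.

Definition sub_mat (R : realType) (p : nat) (A : {set 'I_p})
    (K : 'M[R]_p) : 'M[R]_#|A| :=
  \matrix_(k, l) K (enum_val k) (enum_val l).

(* The ray of the lasso problem with matrix K and vector b that starts at the
   center K^-1 b and corresponds to the sign vector d. *)
Definition lasso_ray (R : realType) (n : nat) (K : 'M[R]_n)
    (b d : 'cV[R]_n) : set 'cV[R]_n :=
  [set g | exists2 s : R,
     s <= 0 & g = invmx K *m b + s *: (invmx K *m d)].

Definition induced_lasso_ray (R : realType) (p N : nat)
    (x : 'I_N -> 'cV[R]_p) (y : 'I_N -> R) (A : {set 'I_p})
    (d : 'cV[R]_#|A|) : set 'cV[R]_p :=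
  [set b | lasso_ray (sub_mat A (gram x)) (sub_vec A (covec x y)) d
             (sub_vec A b) /\
           forall j, j \notin A -> b j 0 = 0].

(* Main.v *)
(* For t <= t_hat the constrained minimizer is characterized by the Kuhn-Tucker
   conditions: the residual g = b - K beta satisfies |g_j| <= lam, with
   g_j = lam sgn(beta_j) where beta_j <> 0, and |beta|_1 = t.  For a fixed sign
   vector these conditions on (beta, t, lam) cut out a convex polyhedron.
   Hence the parameters with a given sign vector form an interval on which
   beta is affine in t, there are finitely many of them, and solving the
   conditions for beta_A, with A the support, puts the segment on a ray.
   The derivatives w of beta and -mu of lam satisfy (K w)_A = mu sigma_A and
   sum sigma_j w_j = 1.  If the directions w, w' of two segments are parallel,
   then w' = w or w' = -w, with the same mu.  Opposite directions would force
   lam + lam' < 0; if w' = w, strict convexity puts both segments on one line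
   with direction w, so that their sign vectors agree. *)
Require Import Defs.
From HB Require Import structures.
From mathcomp Require Import all_boot all_order all_algebra.
From mathcomp Require Import all_classical reals topology normedtype.
From mathcomp Require Import derive ring lra.
Import Order.TTheory GRing.Theory Num.Theory.
Import numFieldNormedType.Exports.
Local Open Scope classical_set_scope.
Local Open Scope ring_scope.
Set Implicit Arguments.
Unset Strict Implicit.
Unset Printing Implicit Defensive.

(** * Functions with convex fibres *)

Lemma mem_sorted_gap (R : realType) (a : R) (ts : seq R) (k : nat) (e : R) :
  path <%R a ts -> (k < size ts)%N -> e \in a :: ts ->
  e <= (a :: ts)`_k \/ ts`_k <= e.
Proof.
move=> ats kts eE.
have srt : sorted <%R (a :: ts) by [].
have ie : (index e (a :: ts) < size (a :: ts))%N by rewrite index_mem.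
have Ee := nth_index 0 eE.
case: (leqP (index e (a :: ts)) k) => h.
  by left; rewrite -Ee (lt_sorted_leq_nth 0 srt) // inE /= ltnS ltnW.
right; rewrite -Ee -[ts`_k]/((a :: ts)`_k.+1).
by rewrite (lt_sorted_leq_nth 0 srt) // inE /=.
Qed.

(** Locates the piece holding the later of two points of a segment. The pieces are left-open, so
    inside the piece there is room to the left of [m]. *)
Lemma path_cover (R : realType) (a : R) (ts : seq R) (m : R) :
  a < m <= last a ts ->
  exists2 k, (k < size ts)%N & (a :: ts)`_k < m <= ts`_k.
Proof.
elim: ts a => [|t ts IH] a /=; first by lra.
move=> /andP[am mt]; case: (leP m t) => mt'; first by exists 0%N => //=; lra.
have [|k ks km] := IH t; first by lra.
by exists k.+1.
Qed.

(* The break points are the suprema of the fibres: if f s <> f t with s < t,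
   then the supremum of the fibre of s lies between s and t. *)
Lemma fibre_partition (R : realType) (F : finType) (f : R -> F) (a b : R) :
  a <= b ->
  (forall s u t, a <= s -> s <= u -> u <= t -> t <= b -> f s = f t ->
    f u = f s) ->
  exists ts : seq R,
    [/\ path <%R a ts, last a ts = b &
        forall k s t, (k < size ts)%N -> (a :: ts)`_k < s < ts`_k ->
          a <= t <= b ->
          ((a :: ts)`_k < t < ts`_k -> f t = f s) /\
          (f t = f s -> (a :: ts)`_k <= t <= ts`_k)].
Proof.
move=> ab fconv.
pose S v := [set u | a <= u <= b /\ f u = v].
(* Empty fibres are left out, as their supremum is only a default value. Listing [b] explicitly
   makes it the last node. *)
pose E := b :: [seq sup (S v) | v <- enum F & `[< S v !=set0 >]].
pose ts := sort <=%R (undup [seq e <- E | a < e]).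
have Sub v : ubound (S v) b by move=> u [/andP[]].
have SupP v u : S v u -> a <= sup (S v) <= b /\ u <= sup (S v).
  move=> Svu; have us : u <= sup (S v).
    by apply: ub_le_sup => //; exists b.
  split=> //; apply/andP; split.
    by apply: le_trans us; case: Svu => /andP[].
  by apply: ge_sup => //; exists u.
have Eb e : e \in E -> e <= b.
  rewrite inE => /orP[/eqP-> //|/mapP[v]].
  rewrite mem_filter => /andP[/asboolP[u Su] _] ->.
  by have [/andP[]] := SupP _ _ Su.
have supE v u : S v u -> sup (S v) \in E.
  move=> Su; rewrite inE; apply/orP; right; apply/mapP; exists v => //.
  by rewrite mem_filter mem_enum andbT; apply/asboolP; exists u.
have tsE e : (e \in ts) = (a < e) && (e \in E).
  by rewrite mem_sort mem_undup mem_filter.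
have ats : path <%R a ts.
  rewrite lt_path_sortedE sort_lt_sorted undup_uniq andbT.
  by apply/allP => e; rewrite tsE => /andP[].
have lts : last a ts = b.
  case: (ltgtP a b) ab => // [ltab _|eab _]; last first.
    suff -> : ts = [::] by [].
    case ts_eq: ts => [|e l] //; have := tsE e.
    by rewrite ts_eq mem_head => /esym/andP[ae /Eb]; rewrite -eab leNgt ae.
  apply/eqP; rewrite eq_le; apply/andP; split.
    have := mem_last a ts; rewrite inE => /orP[/eqP->|]; first exact: ltW.
    by rewrite tsE => /andP[_ /Eb].
  have bts : b \in ts by rewrite tsE ltab mem_head.
  have srt : sorted <%R (a :: ts) by [].
  have be : b \in a :: ts by rewrite inE bts orbT.
  rewrite -(nth_index 0 be) (last_nth 0).
  have idx : (index b (a :: ts) < size (a :: ts))%N by rewrite index_mem.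
  by rewrite (lt_sorted_leq_nth 0 srt) // inE /=.
exists ts; split=> // k s t kts /andP[ks sk] /andP[a_t tb].
have node v u : S v u -> sup (S v) <= (a :: ts)`_k \/ ts`_k <= sup (S v).
  move=> Su; have [/andP[aS _] _] := SupP _ _ Su.
  apply: mem_sorted_gap => //; rewrite inE tsE (supE _ _ Su) andbT.
  by move: aS; rewrite le_eqVlt eq_sym.
have kE : ts`_k \in E by have := mem_nth 0 kts; rewrite tsE => /andP[].
have ak : a <= (a :: ts)`_k.
  have /allP h : all (>= a) (a :: ts).
    rewrite /= lexx; apply/allP => e; rewrite tsE => /andP[ae _].
    exact: ltW.
  by apply/h/mem_nth; rewrite /= ltnS ltnW.
have kb := Eb _ kE.
(* The supremum of the fibre of [u] is not inside the piece, hence lies beyond [v]. So the fibre has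
   a point to the right of [v], and convexity puts [v] in it. *)
have const u v : (a :: ts)`_k < u -> u <= v -> v < ts`_k -> f u = f v.
  move=> ku uv vk.
  have Su : S (f u) u by split=> //; lra.
  have [/andP[aS Sb] us] := SupP _ _ Su.
  have ks' : ts`_k <= sup (S (f u)) by case: (node _ _ Su) => //; lra.
  have vS : v < sup (S (f u)) by lra.
  have [w [/andP[aw wb] fw] vw] := sup_gt (ex_intro _ u Su) vS.
  by apply/esym/(fconv u v w) => //; lra.
(* The supremum of a fibre cannot lie strictly between two points of one
   fibre, which would then be the same fibre, by convexity. *)
have nosup e u w : e \in ts -> a <= u -> u < e -> e < w -> w <= b ->
    f u = f w -> False.
  move=> ets au ue ew wb fuw; move: ets; rewrite tsE inE => /andP[ae].
  move=> /orP[/eqP|/mapP[v]]; first by lra.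
  rewrite mem_filter => /andP[/asboolP[z Sz] _] ev.
  have uS : u < sup (S v) by rewrite -ev.
  have [z' [/andP[az zb] fz] uz] := sup_gt (ex_intro _ z Sz) uS.
  have [_ ze] := SupP v z' (conj (introT andP (conj az zb)) fz).
  have fz' : f z' = f u by apply: (fconv u z' w) => //; lra.
  have [] := SupP v w; last by lra.
  by split; [lra|rewrite -fuw -fz' fz].
split=> [/andP[kt tk]|fts].
  by case: (leP s t) => st; [apply/esym|]; apply: const => //; lra.
apply/andP; split; rewrite leNgt; apply/negP => h.
  apply: (nosup (a :: ts)`_k t s) => //; last by lra.
  (* The node is in [ts] unless it is [a], and [t < a] is excluded. *)
  have : (a :: ts)`_k \in a :: ts by apply: mem_nth; rewrite /= ltnS ltnW.
  by rewrite inE => /orP[/eqP|//]; lra.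
apply: (nosup ts`_k s t) => //; last lra.
  exact: mem_nth.
Qed.

(** * The Kuhn-Tucker conditions *)

Definition dot (R : realType) (p : nat) (u v : 'cV[R]_p) : R :=
  \sum_(j < p) u j 0 * v j 0.

Lemma dot_mulmx (R : realType) (m n : nat) (K : 'M[R]_(m, n))
    (u : 'cV[R]_m) (v : 'cV[R]_n) : dot u (K *m v) = dot (K^T *m u) v.
Proof.
rewrite /dot; under eq_bigr do rewrite mxE mulr_sumr.
rewrite exchange_big; apply: eq_bigr => k _.
rewrite mxE mulr_suml; apply: eq_bigr => j _.
by rewrite mxE mulrCA mulrA.
Qed.

(** * The dot product and the l1 norm *)

Section DotProduct.
Context {R : realType} {p : nat}.
Implicit Types (u v w : 'cV[R]_p) (K : 'M[R]_p) (a : R).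

Lemma dotC u v : dot u v = dot v u.
Proof. by apply: eq_bigr => j _; rewrite mulrC. Qed.

Lemma dotDr u v w : dot u (v + w) = dot u v + dot u w.
Proof. by rewrite -big_split; apply: eq_bigr => j _; rewrite mxE mulrDr. Qed.

Lemma dotZr a u v : dot u (a *: v) = a * dot u v.
Proof. by rewrite mulr_sumr; apply: eq_bigr => j _; rewrite mxE mulrCA. Qed.

Lemma dotNr u v : dot u (- v) = - dot u v.
Proof. by rewrite -scaleN1r dotZr mulN1r. Qed.

Lemma dotBr u v w : dot u (v - w) = dot u v - dot u w.
Proof. by rewrite dotDr dotNr. Qed.

Lemma dotDl u v w : dot (u + v) w = dot u w + dot v w.
Proof. by rewrite dotC dotDr !(dotC w). Qed.

Lemma dotZl a u v : dot (a *: u) v = a * dot u v.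
Proof. by rewrite dotC dotZr dotC. Qed.

Lemma dotNl u v : dot (- u) v = - dot u v.
Proof. by rewrite dotC dotNr dotC. Qed.

Lemma dotBl u v w : dot (u - v) w = dot u w - dot v w.
Proof. by rewrite dotDl dotNl. Qed.

Lemma dot_sumr (I : finType) u (F : I -> 'cV[R]_p) :
  dot u (\sum_i F i) = \sum_i dot u (F i).
Proof.
rewrite /dot exchange_big /=; apply: eq_bigr => j _.
by rewrite summxE mulr_sumr.
Qed.

Lemma dot_sym K u v : K^T = K -> dot u (K *m v) = dot v (K *m u).
Proof. by move=> sK; rewrite dot_mulmx sK dotC. Qed.

Lemma dot_delta u j : dot (delta_mx j 0) u = u j 0.
Proof.
rewrite /dot (bigD1 j) //= mxE !eqxx mul1r big1 ?addr0 // => i ij.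
by rewrite mxE (negbTE ij) mul0r.
Qed.

Lemma l1norm_ge0 u : 0 <= l1norm u.
Proof. exact: sumr_ge0. Qed.

Lemma l1norm0 : l1norm (0 : 'cV[R]_p) = 0.
Proof. by apply: big1 => j _; rewrite mxE normr0. Qed.

Lemma coord_le_l1norm u j : `|u j 0| <= l1norm u.
Proof. by rewrite /l1norm (bigD1 j) //= lerDl sumr_ge0. Qed.

Lemma l1norm_eq0 u : l1norm u <= 0 -> u = 0.
Proof.
move=> u0; apply/matrixP => j i; rewrite ord1 mxE; apply/eqP.
by rewrite -normr_le0; apply: le_trans u0; exact: coord_le_l1norm.
Qed.

Lemma l1norm_delta a j : l1norm (a *: delta_mx j 0 : 'cV[R]_p) = `|a|.
Proof.
rewrite /l1norm (bigD1 j) //= !mxE !eqxx mulr1 big1 ?addr0 // => i ij.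
by rewrite !mxE (negbTE ij) mulr0 normr0.
Qed.

Lemma l1normZ a u : l1norm (a *: u) = `|a| * l1norm u.
Proof. by rewrite mulr_sumr; apply: eq_bigr => j _; rewrite mxE normrM. Qed.

Lemma l1normD u v : l1norm (u + v) <= l1norm u + l1norm v.
Proof.
by rewrite -big_split; apply: ler_sum => j _; rewrite mxE ler_normD.
Qed.

(** The Hölder inequality between the sup norm and the l1 norm. *)
Lemma dot_le_l1norm u v a :
  (forall j, `|v j 0| <= a) -> dot u v <= a * l1norm u.
Proof.
move=> va; rewrite mulr_sumr; apply: ler_sum => j _.
by rewrite (le_trans (ler_norm _)) // normrM mulrC ler_wpM2r.
Qed.

Lemma dot_sign_vector u : dot (sign_vector u) u = l1norm u.
Proof. by apply: eq_bigr => j _; rewrite mxE -normrEsg. Qed.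

End DotProduct.

(** * Continuity of expressions in the coordinates *)

Section CoordContinuity.
Context {R : realType} {X : topologicalType}.

Lemma sum_continuous (p : nat) (F : 'I_p -> X -> R) :
  (forall j, continuous (F j)) -> continuous (fun x => \sum_j F j x).
Proof.
move=> cF; apply: continuous_big => [x|j _]; last exact: cF.
exact: add_continuous.
Qed.

Lemma scaler_continuous (a : R) (f : X -> R) :
  continuous f -> continuous (fun x => a * f x).
Proof. by move=> cf x; apply: cvgM; [exact: cvg_cst|exact: cf]. Qed.

Lemma dot_continuous (p : nat) (F G : X -> 'cV[R]_p) :
  (forall j, continuous (fun x => F x j 0)) ->
  (forall j, continuous (fun x => G x j 0)) ->
  continuous (fun x => dot (F x) (G x)).
Proof.
move=> cF cG; apply: sum_continuous => j x.
by apply: cvgM; [exact: cF|exact: cG].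
Qed.

Lemma l1norm_continuous (p : nat) (F : X -> 'cV[R]_p) :
  (forall j, continuous (fun x => F x j 0)) ->
  continuous (fun x => l1norm (F x)).
Proof.
by move=> cF; apply: sum_continuous => j x; apply: cvg_norm; exact: cF.
Qed.

Lemma mulmx_continuous (p : nat) (K : 'M[R]_p) (F : X -> 'cV[R]_p) :
  (forall j, continuous (fun x => F x j 0)) ->
  forall j, continuous (fun x => (K *m F x) j 0).
Proof.
move=> cF j; under eq_fun do rewrite mxE.
by apply: sum_continuous => k; exact: scaler_continuous.
Qed.

End CoordContinuity.

(** If [A] were negative, then [u = 1] would give [D >= - A > 0], and at [u = - A / (2 * D)] the
    value would be [A / 2]. *)
Lemma affine_ge0_at0 (R : realFieldType) (A D : R) :
  (forall u, 0 < u <= 1 -> 0 <= A + u * D) -> 0 <= A.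
Proof.
move=> h; rewrite leNgt; apply/negP => A0.
have D1 := h 1 ltac:(lra).
have D0 : 0 < D by lra.
have : 0 <= A + (- A / (2 * D)) * D.
  apply: h; rewrite divr_gt0 ?ler_pdivrMr ?mulr_gt0 //; lra.
suff -> : - A / (2 * D) * D = - A / 2 by lra.
by field; rewrite gt_eqF.
Qed.

Lemma affine_ge0_closure (R : realFieldType) (A B m e e' : R) :
  e < e' -> (forall t, e < t < e' -> 0 <= A + (t - m) * B) ->
  forall t, e <= t <= e' -> 0 <= A + (t - m) * B.
Proof.
move=> ee h t et.
(* Moving from [t] towards the midpoint by a fraction [u] in (0, 1] enters the open interval. *)
apply: (@affine_ge0_at0 _ _ (((e + e') / 2 - t) * B)) => u u01.
have -> : A + (t - m) * B + u * (((e + e') / 2 - t) * B) =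
          A + (t + u * ((e + e') / 2 - t) - m) * B by ring.
by apply: h; nra.
Qed.

Lemma affine_eq0_closure (R : realFieldType) (A B m e e' : R) :
  e < e' -> (forall t, e < t < e' -> A + (t - m) * B = 0) ->
  forall t, e <= t <= e' -> A + (t - m) * B = 0.
Proof.
move=> ee h t et; apply/eqP; rewrite eq_le; apply/andP; split; last first.
  by apply: (affine_ge0_closure ee) => // u /h ->.
rewrite -oppr_ge0 opprD -mulrN.
by apply: (affine_ge0_closure ee) => // u /h; lra.
Qed.

(** * Kuhn-Tucker points of a positive definite quadratic form *)

Section Kkt.
Context {R : realType} {p : nat} (K : 'M[R]_p) (b : 'cV[R]_p).
Hypothesis K_sym : K^T = K.
Hypothesis K_pd : forall v : 'cV[R]_p, v != 0 -> 0 < dot v (K *m v).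
Implicit Types (s beta gamma w v : 'cV[R]_p) (t lam mu m u e : R).

Let resid beta := b - K *m beta.

(* The Kuhn-Tucker conditions with multiplier [lam] on the closed orthant face
   of the sign vector [s]; this is a closed convex condition on
   (beta, t, lam). *)
Record kkt s beta t lam : Prop := Kkt {
  kkt_ge0 : 0 <= lam;
  kkt_le : forall j, `|resid beta j 0| <= lam;
  kkt_eq : forall j, s j 0 != 0 -> resid beta j 0 = lam * s j 0;
  kkt_supp : forall j, s j 0 = 0 -> beta j 0 = 0;
  kkt_sgn : forall j, 0 <= s j 0 * beta j 0;
  kkt_dot : dot s beta = t }.

(** For the matrix and vector of a data set this is the lasso objective up to a positive factor and
    an additive constant. *)
Definition phi beta := dot beta (K *m beta) - 2 * dot b beta.

Lemma K_pd_eq0 v : dot v (K *m v) <= 0 -> v = 0.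
Proof.
move=> v0; apply/eqP; apply/negPn/negP => /K_pd.
by rewrite ltNge v0.
Qed.

(** Exact second-order expansion at [beta], where the gradient is [-2] times the residual. *)
Lemma phi_diff beta gamma :
  phi gamma - phi beta = dot (gamma - beta) (K *m (gamma - beta))
                         - 2 * dot (gamma - beta) (resid beta).
Proof.
rewrite /phi /resid mulmxBr !dotBr !dotBl (dotC beta b) (dotC gamma b).
by rewrite (dot_sym gamma beta K_sym); ring.
Qed.

(** The entries of [s] are -1, 0 or 1, so the sign and support conditions turn each term of
    [dot s beta] into an absolute value. *)
Lemma kkt_l1norm s beta t lam :
  sign_vector s = s -> kkt s beta t lam -> l1norm beta = t.
Proof.
move=> ss [_ _ _ supp sgn <-]; apply: eq_bigr => j _.
have sE : Num.sg (s j 0) = s j 0 by rewrite -{2}ss mxE.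
rewrite -(ger0_norm (sgn j)) normrM -sE normr_sg.
by case: eqVneq => [/supp ->|]; rewrite ?normr0 ?mulr0 ?mul1r.
Qed.

Lemma kkt_dot_supp s beta t lam v :
  kkt s beta t lam -> (forall j, s j 0 = 0 -> v j 0 = 0) ->
  dot v (resid beta) = lam * dot s v.
Proof.
move=> [_ _ eq _ _ _] supp; rewrite mulr_sumr; apply: eq_bigr => j _.
have [/supp ->|/eq ->] := eqVneq (s j 0) 0; first by rewrite mul0r !mulr0.
by ring.
Qed.

Lemma kkt_dot_resid s beta t lam :
  kkt s beta t lam -> dot beta (resid beta) = lam * t.
Proof. by move=> kb; rewrite (kkt_dot_supp kb (kkt_supp kb)) (kkt_dot kb). Qed.

(** The quadratic term of the expansion is positive. The linear one has the right sign, because the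
    residual pairs with [gamma] to at most [lam * t], its value at [beta]. *)
Lemma kkt_phi_lt s beta t lam gamma :
  kkt s beta t lam -> l1norm gamma <= t -> gamma != beta ->
  phi beta < phi gamma.
Proof.
move=> kb gt gb; rewrite -subr_gt0 phi_diff.
have := K_pd (v := gamma - beta); rewrite subr_eq0 => /(_ gb) Q0.
suff : dot (gamma - beta) (resid beta) <= 0 by lra.
rewrite dotBl (kkt_dot_resid kb) subr_le0.
apply: le_trans (dot_le_l1norm _ (kkt_le kb)) _.
exact: ler_wpM2l (kkt_ge0 kb) _ _ gt.
Qed.

(** Both points have l1 norm [t]; if they differed, each would have the strictly smaller value of
    [phi]. *)
Lemma kkt_unique s s' beta beta' t lam lam' :
  sign_vector s = s -> sign_vector s' = s' ->
  kkt s beta t lam -> kkt s' beta' t lam' -> beta = beta'.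
Proof.
move=> ss ss' kb kb'; apply/eqP/negPn/negP => bb.
have := kkt_phi_lt kb' _ bb; rewrite (kkt_l1norm ss kb) lexx => /(_ erefl).
rewrite eq_sym in bb.
have := kkt_phi_lt kb _ bb; rewrite (kkt_l1norm ss' kb') lexx => /(_ erefl).
by lra.
Qed.

(** The last hypothesis excludes an unconstrained minimizer in the interior of the ball, whose l1
    norm would be less than [t]. *)
Lemma minimizer_kkt beta t :
  0 <= t -> l1norm beta <= t ->
  (forall gamma, l1norm gamma <= t -> phi beta <= phi gamma) ->
  (K *m beta = b -> t <= l1norm beta) ->
  exists lam, kkt (sign_vector beta) beta t lam.
Proof.
move=> t0 bt bmin bhat.
have supp j : sign_vector beta j 0 = 0 -> beta j 0 = 0.
  by rewrite mxE => /eqP; rewrite sgr_eq0 => /eqP.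
have sgn j : 0 <= sign_vector beta j 0 * beta j 0 by rewrite mxE -normrEsg.
have [t_eq0|t_neq0] := eqVneq t 0.
  have beta0 : beta = 0 by apply: l1norm_eq0; rewrite -t_eq0.
  have resid0 : resid beta = b by rewrite /resid beta0 mulmx0 subr0.
  (* At [t = 0] any bound on the entries of [b] is a multiplier. *)
  exists (l1norm b); split=> // [|j|j|]; first exact: l1norm_ge0.
  - by rewrite resid0; exact: coord_le_l1norm.
  - by rewrite beta0 !mxE sgr0 eqxx.
  - by rewrite dot_sign_vector beta0 l1norm0.
have tpos : 0 < t by rewrite lt_def t_neq0.
(* First-order condition: along the segment to [gamma], the increase of [phi] divided by the step
   [u] is affine in [u] and nonnegative, hence also at 0. *)
have var gamma : l1norm gamma <= t -> dot (gamma - beta) (resid beta) <= 0.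
  move=> gt; rewrite -oppr_ge0 -(pmulr_rge0 _ (ltr0n R 2)).
  apply: (@affine_ge0_at0 _ _
    (dot (gamma - beta) (K *m (gamma - beta)))) => u /andP[u0 u1].
  have feas : l1norm (beta + u *: (gamma - beta)) <= t.
    have -> : beta + u *: (gamma - beta) = (1 - u) *: beta + u *: gamma.
      by apply/matrixP => i j; rewrite !mxE; ring.
    apply: le_trans (l1normD _ _) _; rewrite !l1normZ !ger0_norm; [nra|lra|lra].
  have := bmin _ feas; rewrite -subr_ge0 phi_diff [_ + _ - _]addrAC subrr add0r.
  rewrite -!scalemxAr !dotZl !dotZr => h.
  rewrite -(pmulr_rge0 _ u0); move: h; rewrite mulrN.
  by set A := dot _ _; set B := dot _ _; nra.
have le j : `|resid beta j 0| <= dot beta (resid beta) / t.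
  (* The test point is the vertex of the ball on the axis of [j], on the side given by the sign of
     the residual. *)
  have := var ((t * Num.sg (resid beta j 0)) *: delta_mx j 0).
  rewrite l1norm_delta normrM normr_sg ger0_norm //.
  rewrite dotBl dotZl dot_delta -mulrA -normrEsg.
  rewrite subr_le0 ler_pdivlMr // [`|_| * t]mulrC; apply.
  by case: eqP => _; rewrite ?mulr0 ?mulr1.
set lam := _ / t in le.
have lamt : dot beta (resid beta) = lam * t by rewrite /lam divfK.
(* A coordinate is needed to see that [lam] is nonnegative. Without one, [K *m beta = b] holds
   trivially and [bhat] contradicts [0 < t]. *)
have [j0|/forallNP nop] := pselect (exists j : 'I_p, True); last first.
  have b0 : beta = 0 by apply/matrixP => j; have := nop j.
  have : K *m beta = b by apply/matrixP => j; have := nop j.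
  by move/bhat; rewrite b0 l1norm0 leNgt tpos.
have lam0 : 0 <= lam by case: j0 => j _; apply: le_trans (le j).
have betat : l1norm beta = t.
  apply/eqP; rewrite eq_le bt /=.
  have [lam_eq0|lam_neq0] := eqVneq lam 0.
    apply: bhat; apply/esym/subr0_eq/matrixP => j i; rewrite ord1 [RHS]mxE.
    by apply/eqP; rewrite -normr_le0 -lam_eq0.
  have lampos : 0 < lam by rewrite lt_def lam_neq0.
  rewrite -(ler_pM2l lampos) -lamt; exact: dot_le_l1norm.
exists lam; split=> //; last by rewrite dot_sign_vector.
(* Complementary slackness: these nonnegative terms have sum 0, so each vanishes, which fixes the
   residual wherever [beta] is nonzero. *)
have term0 j : 0 <= lam * `|beta j 0| - beta j 0 * resid beta j 0.
  rewrite subr_ge0 (le_trans (ler_norm _)) // normrM mulrC.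
  by rewrite ler_wpM2r.
have sum0 : \sum_j (lam * `|beta j 0| - beta j 0 * resid beta j 0) = 0.
  by rewrite sumrB -mulr_sumr -/(l1norm beta) betat -lamt subrr.
move=> j; rewrite mxE sgr_eq0 => bj.
have /eqP := sum0; rewrite psumr_eq0 // => /allP/(_ j (mem_index_enum j)).
rewrite /= subr_eq0 => /eqP h.
apply: (mulfI bj); rewrite -h normrEsg; ring.
Qed.

Lemma kkt_convex s beta0 beta1 t0 t1 lam0 lam1 u :
  kkt s beta0 t0 lam0 -> kkt s beta1 t1 lam1 -> 0 <= u <= 1 ->
  kkt s ((1 - u) *: beta0 + u *: beta1) ((1 - u) * t0 + u * t1)
    ((1 - u) * lam0 + u * lam1).
Proof.
move=> [p0 le0 eq0 supp0 sgn0 dot0] [p1 le1 eq1 supp1 sgn1 dot1] /andP[u0 u1].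
have residE j : resid ((1 - u) *: beta0 + u *: beta1) j 0 =
    (1 - u) * resid beta0 j 0 + u * resid beta1 j 0.
  by rewrite /resid mulmxDr -!scalemxAr !mxE; ring.
have v0 : 0 <= 1 - u by lra.
split=> [|j|j sj|j sj|j|].
- by apply: addr_ge0; apply: mulr_ge0.
- rewrite residE; apply: le_trans (ler_normD _ _) _.
  rewrite !normrM (ger0_norm v0) (ger0_norm u0).
  by apply: lerD; apply: ler_wpM2l.
- by rewrite residE eq0 // eq1 //; ring.
- by rewrite !mxE supp0 // supp1 // !mulr0 addr0.
- rewrite !mxE mulrDr ![s j 0 * (_ * _)]mulrCA.
  by apply: addr_ge0; apply: mulr_ge0.
- by rewrite dotDr !dotZr dot0 dot1.
Qed.

(* [w] and [- mu] are the derivatives in t of beta and of the multiplier along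
   a solution with constant sign vector [s]. *)
Record face_direction s w mu : Prop := FaceDirection {
  face_eq : forall j, s j 0 != 0 -> (K *m w) j 0 = mu * s j 0;
  face_supp : forall j, s j 0 = 0 -> w j 0 = 0;
  face_dot : dot s w = 1 }.

(** The condition [dot s w = 1] is not assumed, so that the lemma also covers the difference of two
    directions. *)
Lemma face_quad s w mu v :
  (forall j, s j 0 != 0 -> (K *m w) j 0 = mu * s j 0) ->
  (forall j, s j 0 = 0 -> v j 0 = 0) ->
  dot v (K *m w) = mu * dot s v.
Proof.
move=> eq supp; rewrite mulr_sumr; apply: eq_bigr => j _.
have [/supp ->|/eq ->] := eqVneq (s j 0) 0; first by rewrite mul0r !mulr0.
by ring.
Qed.

Lemma face_direction_neq0 s w mu : face_direction s w mu -> w != 0.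
Proof.
case=> _ _ d1; apply/eqP => w0; move: d1; rewrite w0 /dot big1 ?(rwP eqP).
  by rewrite eq_sym oner_eq0.
by move=> j _; rewrite mxE mulr0.
Qed.

Lemma face_direction_quad s w mu :
  face_direction s w mu -> dot w (K *m w) = mu.
Proof. by case=> eq supp d1; rewrite (face_quad eq supp) d1 mulr1. Qed.

Lemma face_direction_gt0 s w mu : face_direction s w mu -> 0 < mu.
Proof.
move=> fd; rewrite -(face_direction_quad fd); apply: K_pd.
exact: face_direction_neq0 fd.
Qed.

(** The difference of two directions solves the same equations with [dot s] equal to 0, so its
    quadratic form vanishes. *)
Lemma face_direction_unique s w w' mu mu' :
  face_direction s w mu -> face_direction s w' mu' -> w = w' /\ mu = mu'.
Proof.
move=> fd fd'; have ww : w = w'.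
  apply/subr0_eq/K_pd_eq0.
  have [eq supp d1] := fd; have [eq' supp' d1'] := fd'.
  rewrite (@face_quad s (w - w') (mu - mu')) => [|j sj|j sj].
  - by rewrite dotBr d1 d1' subrr mulr0.
  - by rewrite mulmxBr mxE [X in _ + X]mxE eq // eq' //; ring.
  - by rewrite mxE [X in _ + X]mxE supp // supp' // subrr.
by split=> //; rewrite -(face_direction_quad fd) -(face_direction_quad fd') ww.
Qed.

(** The direction is the difference quotient; subtracting the two residual equations on the support
    of [s] gives [face_eq]. *)
Lemma kkt_direction s beta0 beta1 t0 t1 lam0 lam1 :
  kkt s beta0 t0 lam0 -> kkt s beta1 t1 lam1 -> t0 != t1 ->
  exists w mu, [/\ face_direction s w mu,
    beta1 = beta0 + (t1 - t0) *: w & lam1 = lam0 - (t1 - t0) * mu].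
Proof.
move=> [_ _ eq0 supp0 _ dot0] [_ _ eq1 supp1 _ dot1] t01.
have t10 : t1 - t0 != 0 by rewrite subr_eq0 eq_sym.
exists ((t1 - t0)^-1 *: (beta1 - beta0)), ((t1 - t0)^-1 * (lam0 - lam1)).
split; last 2 first.
- by rewrite scalerA mulfV // scale1r addrC subrK.
- by rewrite mulrA mulfV // mul1r; ring.
split=> [j sj|j sj|].
- have := eq0 _ sj; have := eq1 _ sj; rewrite -scalemxAr mulmxBr !mxE => h1 h0.
  by rewrite -mulrA mulrBl -h0 -h1; congr (_ * _); ring.
- by rewrite !mxE supp0 // supp1 // subrr mulr0.
- by rewrite dotZr dotBr dot0 dot1 mulVf.
Qed.

(** Along a line each condition is an affine equation or weak inequality in [t], and these pass to
    the end points. *)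
Lemma kkt_closure s beta w m lam mu e e' : e < e' ->
  (forall t, e < t < e' ->
    kkt s (beta + (t - m) *: w) t (lam - (t - m) * mu)) ->
  forall t, e <= t <= e' ->
    kkt s (beta + (t - m) *: w) t (lam - (t - m) * mu).
Proof.
move=> ee h t et.
have residE u j : resid (beta + u *: w) j 0 =
    resid beta j 0 - u * (K *m w) j 0.
  by rewrite /resid mulmxDr -!scalemxAr !mxE; ring.
split=> [|j|j sj|j sj|j|].
- rewrite -mulrN; apply: (affine_ge0_closure ee) et => u /h[+ _ _ _ _ _].
  by rewrite mulrN.
- rewrite ler_norml residE; apply/andP; split; rewrite -subr_ge0.
    have -> : resid beta j 0 - (t - m) * (K *m w) j 0 - - (lam - (t - m) * mu) =
      (resid beta j 0 + lam) + (t - m) * (- (K *m w) j 0 - mu) by ring.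
    apply: (affine_ge0_closure ee) et => u /h[_ /(_ j) + _ _ _ _].
    by rewrite ler_norml residE => /andP[? ?]; lra.
  have -> : lam - (t - m) * mu - (resid beta j 0 - (t - m) * (K *m w) j 0) =
    (lam - resid beta j 0) + (t - m) * ((K *m w) j 0 - mu) by ring.
  apply: (affine_ge0_closure ee) et => u /h[_ /(_ j) + _ _ _ _].
  by rewrite ler_norml residE => /andP[? ?]; lra.
- rewrite residE; apply/eqP; rewrite -subr_eq0; apply/eqP.
  have -> : resid beta j 0 - (t - m) * (K *m w) j 0 -
      (lam - (t - m) * mu) * s j 0 = (resid beta j 0 - lam * s j 0) +
      (t - m) * (mu * s j 0 - (K *m w) j 0) by ring.
  apply: (affine_eq0_closure ee) et => u /h[_ _ /(_ j sj) + _ _ _].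
  by rewrite residE; lra.
- rewrite !mxE; apply: (affine_eq0_closure ee) et => u.
  move=> /h[_ _ _ /(_ j sj) + _ _]; by rewrite !mxE.
- rewrite !mxE mulrDr mulrCA; apply: (affine_ge0_closure ee) et.
  by move=> u /h[_ _ _ _ /(_ j) + _]; rewrite !mxE mulrDr mulrCA.
- rewrite dotDr dotZr; apply/eqP; rewrite -subr_eq0; apply/eqP.
  have -> : dot s beta + (t - m) * dot s w - t =
    (dot s beta - m) + (t - m) * (dot s w - 1) by ring.
  apply: (affine_eq0_closure ee) et => u /h[_ _ _ _ _].
  by rewrite dotDr dotZr; lra.
Qed.

(** Comparing quadratic forms gives [mu' = c ^+ 2 * mu]. Where [w] is nonzero, the two face
    equations then give [s = c * s'], and since both signs have absolute value 1, so has [c]. *)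
Lemma parallel_face_coef s s' w w' mu mu' c :
  sign_vector s = s -> sign_vector s' = s' ->
  face_direction s w mu -> face_direction s' w' mu' -> w' = c *: w ->
  [/\ c = 1 \/ c = -1, mu' = mu &
      forall j, w j 0 != 0 -> s j 0 != 0 /\ s' j 0 = c * s j 0].
Proof.
move=> ss ss' fd fd' wE.
have c0 : c != 0.
  by apply: contraNneq (face_direction_neq0 fd') => c0; rewrite wE c0 scale0r.
have mu_neq0 : mu != 0 by rewrite gt_eqF // (face_direction_gt0 fd).
have muE : mu' = c ^+ 2 * mu.
  rewrite -(face_direction_quad fd) -(face_direction_quad fd') wE.
  by rewrite -scalemxAr dotZl dotZr; ring.
have coef j : w j 0 != 0 -> s j 0 != 0 /\ s j 0 = c * s' j 0.
  move=> wj; have sj : s j 0 != 0 by apply: contra_neq wj => /(face_supp fd).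
  have sj' : s' j 0 != 0.
    apply: contra_neq wj => /(face_supp fd')/eqP.
    by rewrite wE mxE mulf_eq0 (negbTE c0) /= => /eqP.
  split=> //; apply: (mulfI c0); apply: (mulfI mu_neq0).
  have := face_eq fd' sj'; rewrite wE -scalemxAr mxE (face_eq fd sj) muE => h.
  by transitivity (c * (mu * s j 0)); [|rewrite h]; ring.
have sg1 (r : 'cV[R]_p) j : sign_vector r = r -> r j 0 != 0 -> `|r j 0| = 1.
  by move=> rr rj; rewrite -rr mxE normr_sg; move: rj; case: eqP.
have [j wj] : exists j, w j 0 != 0.
  apply/not_existsP => w0; have /eqP := face_direction_neq0 fd; apply.
  apply/matrixP => j i; rewrite ord1 mxE; apply/eqP/negPn/negP; exact: w0.
have c1 : c = 1 \/ c = -1.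
  have [sj sE] := coef _ wj.
  have sj' : s' j 0 != 0 by apply: contra_neq sj => s0; rewrite sE s0 mulr0.
  have : `|c| = 1.
    by have := sg1 _ _ ss sj; rewrite sE normrM (sg1 _ _ ss' sj') mulr1.
  by move/eqP; rewrite eqr_norml ler01 andbT => /orP[]/eqP; [left|right].
have cc : c * c = 1 by case: c1 => ->; rewrite ?mulrNN mulr1.
split=> // [|i /coef[si sE]]; first by rewrite muE expr2 cc mul1r.
by split=> //; rewrite sE mulrA cc mul1r.
Qed.

(* If the two directions agree then D := beta' - beta satisfies
   <K (D - (t' - t) w), D - (t' - t) w> <= 0, so that beta' and beta differ
   only in coordinates where both sign vectors are nonzero and agree.  If
   they are opposite then lam + lam' = - mu (t + t'). *)
Lemma parallel_faces s s' beta beta' t t' lam lam' w w' mu mu' c :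
  sign_vector beta = s -> sign_vector beta' = s' ->
  kkt s beta t lam -> kkt s' beta' t' lam' -> 0 < t -> 0 <= t' ->
  face_direction s w mu -> face_direction s' w' mu' -> w' = c *: w ->
  s = s'.
Proof.
move=> sb sb' kb kb' t0 t0' fd fd' wE.
have sgK (u : 'cV[R]_p) : sign_vector (sign_vector u) = sign_vector u.
  by apply/matrixP => i j; rewrite !mxE sgr_id.
have ss : sign_vector s = s by rewrite -sb sgK.
have ss' : sign_vector s' = s' by rewrite -sb' sgK.
have mu0 := face_direction_gt0 fd.
have lam0 := kkt_ge0 kb; have lam0' := kkt_ge0 kb'.
have [c1 muE coef] := parallel_face_coef ss ss' fd fd' wE.
have cc : c * c = 1 by case: c1 => ->; rewrite ?mulrNN mulr1.
have wE' : w = c *: w' by rewrite wE scalerA cc scale1r.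
have supp' j : s' j 0 = 0 -> w j 0 = 0.
  by move=> /(face_supp fd') w0; rewrite wE' mxE w0 mulr0.
have residD : K *m (beta' - beta) = resid beta - resid beta'.
  by rewrite /resid mulmxBr opprB [RHS]addrC addrA subrK.
(* The same number is computed twice, here from the residuals and in [DKw] from the face
   equations. *)
have wKD : dot w (K *m (beta' - beta)) = lam - c * lam'.
  rewrite residD dotBr (kkt_dot_supp kb (face_supp fd)) (face_dot fd).
  by rewrite (kkt_dot_supp kb' supp') wE' dotZr (face_dot fd'); ring.
have DKw : dot w (K *m (beta' - beta)) = mu * (c * t' - t).
  rewrite (dot_sym _ _ K_sym) dotBl.
  rewrite (face_quad (face_eq fd) (kkt_supp kb)) (kkt_dot kb).
  rewrite wE' -scalemxAr dotZr (face_quad (face_eq fd') (kkt_supp kb')).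
  by rewrite (kkt_dot kb') muE; ring.
case: c1 => cE; last first.
  have mut : 0 < mu * t by exact: mulr_gt0.
  have mut' : 0 <= mu * t' by apply: mulr_ge0 => //; exact: ltW.
  have : lam - c * lam' = mu * (c * t' - t) by rewrite -wKD.
  have -> : mu * (c * t' - t) = c * (mu * t') - mu * t by ring.
  rewrite cE => h; have : lam + lam' < 0 by lra.
  by rewrite ltNge addr_ge0.
(* With residuals [r] and [r'], Hölder bounds the mixed products [dot beta' r] and [dot beta r'] by
   [lam * t'] and [lam' * t]; the unmixed ones equal [lam * t] and [lam' * t']. *)
have QD : dot (beta' - beta) (K *m (beta' - beta)) <=
    (lam - lam') * (t' - t).
  have := dot_le_l1norm beta' (kkt_le kb); rewrite (kkt_l1norm ss' kb').
  have := dot_le_l1norm beta (kkt_le kb'); rewrite (kkt_l1norm ss kb).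
  have := kkt_dot_resid kb; have := kkt_dot_resid kb'; rewrite residD.
  move: (resid beta) (resid beta') => r r'.
  by rewrite dotBl !dotBr; lra.
have D0 : beta' - beta - (t' - t) *: w = 0.
  rewrite cE in wKD DKw; move: QD wKD DKw; set D := beta' - beta.
  move=> QD wKD DKw; apply: K_pd_eq0.
  rewrite mulmxBr -scalemxAr dotBl !dotBr !dotZl !dotZr.
  rewrite (dot_sym D w K_sym) (face_direction_quad fd) DKw.
  have lamE : lam - lam' = mu * (t' - t).
    by transitivity (dot w (K *m D)); [rewrite wKD|rewrite DKw]; ring.
  by rewrite lamE in QD; lra.
apply/matrixP => j i; rewrite ord1.
have [wj|wj] := eqVneq (w j 0) 0.
  have /matrixP/(_ j 0) := D0; rewrite !mxE wj mulr0 subr0 => /subr0_eq bE.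
  by rewrite -sb -sb' !mxE bE.
by have [_ ->] := coef _ wj; rewrite cE mul1r.
Qed.

Lemma phi_continuous (X : topologicalType) (F : X -> 'cV[R]_p) :
  (forall j, continuous (fun x => F x j 0)) ->
  continuous (fun x => phi (F x)).
Proof.
move=> cF.
have c1 : continuous (fun x => dot (F x) (K *m F x)).
  by apply: dot_continuous => //; exact: mulmx_continuous.
have c2 : continuous (fun x => 2 * dot b (F x)).
  apply: scaler_continuous; apply: (@dot_continuous _ _ _ (fun=> b)) => // j y.
  exact: cvg_cst.
by move=> x; apply: cvgB; [exact: c1|exact: c2].
Qed.

Lemma exists_minimizer t : 0 <= t ->
  exists2 beta, l1norm beta <= t &
    forall gamma, l1norm gamma <= t -> phi beta <= phi gamma.
Proof.
(* Compactness is taken in the space of row vectors, hence the transposition. *)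
move=> t0; pose T (r : 'rV[R]_p) : 'cV[R]_p := r^T.
have cc j : continuous (fun r : 'rV[R]_p => T r j 0).
  move=> r; rewrite /T; under eq_fun do rewrite mxE.
  exact: coord_continuous.
have cl : continuous (fun r : 'rV[R]_p => l1norm (T r)).
  exact: l1norm_continuous.
have cphi := phi_continuous cc.
pose A := [set r | l1norm (T r) <= t].
have A0 : A !=set0 by exists 0; rewrite /A /T /= trmx0 l1norm0.
have cA : compact A.
  apply: bounded_closed_compact.
    rewrite /bounded_set /=; exists t; split; first exact: num_real.
    move=> M tM r Av; change (mx_norm r <= M); rewrite mx_normrE.
    apply: bigmax_le => [|[i j] _ /=]; first exact: ltW (le_lt_trans t0 tM).
    have := coord_le_l1norm (T r) j; rewrite mxE ord1 => /le_trans; apply.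
    exact: le_trans Av (ltW tM).
  apply: (@closed_comp _ _ (fun r : 'rV[R]_p => l1norm (T r)) [set x | x <= t]).
    by move=> r _; exact: cl.
  exact: closed_le.
have [r /set_mem Av vmin] := compact_EVT_min A0 cA (continuous_subspaceT cphi).
exists (T r) => // gamma gt.
have := vmin gamma^T; rewrite inE /A /= /T trmxK; exact.
Qed.

End Kkt.

(** * Data sets and coordinate subspaces *)

Section Data.
Context {R : realType} {p N : nat} (x : 'I_N -> 'cV[R]_p) (y : 'I_N -> R).
Implicit Types (u v : 'cV[R]_p).

Lemma dot_outer u v : (u *m u^T) *m v = dot u v *: u.
Proof.
apply/matrixP => i j; rewrite ord1 -mulmxA !mxE big_ord1 !mxE mulrC.
by congr (_ * _); apply: eq_bigr => k _; rewrite mxE.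
Qed.

Lemma gram_quad v :
  dot v (gram x *m v) = N%:R^-1 * \sum_(i < N) dot v (x i) ^+ 2.
Proof.
rewrite -scalemxAl dotZr mulmx_suml dot_sumr; congr (_ * _).
by apply: eq_bigr => i _; rewrite dot_outer dotZr (dotC _ v) expr2.
Qed.

Lemma gram_sym : (gram x)^T = gram x.
Proof.
rewrite /gram linearZ linear_sum /=; congr (_ *: _).
by apply: eq_bigr => i _; rewrite trmx_mul trmxK.
Qed.

Lemma dot_covec v :
  dot (covec x y) v = N%:R^-1 * \sum_(i < N) y i * dot v (x i).
Proof.
rewrite dotC /covec dotZr dot_sumr; congr (_ * _).
by apply: eq_bigr => i _; rewrite dotZr.
Qed.

Lemma lasso_objectiveE v : N != 0%N ->
  lasso_objective x y v =
  N%:R / 2 * phi (gram x) (covec x y) v + 2^-1 * \sum_(i < N) y i ^+ 2.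
Proof.
move=> N0; rewrite /lasso_objective /phi gram_quad dot_covec.
have N0' : N%:R != 0 :> R by rewrite pnatr_eq0.
have -> : \sum_(i < N) (y i - \sum_(j < p) v j 0 * x i j 0) ^+ 2 =
  \sum_(i < N) dot v (x i) ^+ 2 - 2 * (\sum_(i < N) y i * dot v (x i)) +
  \sum_(i < N) y i ^+ 2.
  rewrite mulr_sumr -sumrB -big_split; apply: eq_bigr => i _ /=.
  by rewrite -/(dot v (x i)); ring.
by move: (\sum_(i < N) dot v (x i) ^+ 2) => S; field.
Qed.

(** If [v] were orthogonal to all [x i], the data would lie in the kernel of the functional
    [row_mx v^T 0], which is proper because [col_mx v 0] is not in it. *)
Lemma full_rank_dot v : full_rank_data x y -> v != 0 ->
  exists i, dot v (x i) != 0.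
Proof.
move=> hrank v0; apply/not_existsP => vx; apply: hrank.
pose h : 'Hom('cV[R]_(p + 1), 'cV[R]_1) := linfun (mulmx (row_mx v^T 0)).
exists 0, (lker h); split; last first.
  move=> i; rewrite subr0 memv_ker lfunE /= mul_row_col mul0mx addr0.
  apply/eqP/matrixP => k l; rewrite !ord1 !mxE.
  transitivity (dot v (x i)); last by apply/eqP/negPn/negP; exact: vx.
  by apply: eq_bigr => j _; rewrite mxE.
apply/negP => /eqP kerT.
have : col_mx v 0 \in lker h by rewrite kerT memvf.
rewrite memv_ker lfunE /= mul_row_col mul0mx addr0 => /eqP/matrixP/(_ 0 0).
rewrite !mxE => vv; move/eqP: v0; apply; apply/matrixP => j k.
rewrite ord1 mxE; apply/eqP; rewrite -sqrf_eq0 expr2.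
have /eqP := vv; rewrite psumr_eq0 => [|i _].
  2: by rewrite mxE -expr2 sqr_ge0.
by move=> /allP/(_ j (mem_index_enum j)); rewrite mxE.
Qed.

Lemma gram_pd : full_rank_data x y ->
  forall v, v != 0 -> 0 < dot v (gram x *m v).
Proof.
move=> hrank v /(full_rank_dot hrank)[i vi]; rewrite gram_quad.
apply: mulr_gt0.
  by rewrite invr_gt0 ltr0n; case: i {vi}; case: (N).
rewrite (bigD1 i) //=; apply: ltr_pwDl.
  2: by apply: sumr_ge0 => k _; exact: sqr_ge0.
by rewrite lt_def sqr_ge0 sqrf_eq0 vi.
Qed.

End Data.

Lemma unitmx_pd (R : realType) (n : nat) (M : 'M[R]_n) :
  (forall v : 'cV[R]_n, v != 0 -> 0 < dot v (M *m v)) -> M \in unitmx.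
Proof.
move=> pd; rewrite unitmxE unitfE; apply/negP => /det0P[v v0 vM].
have := pd v^T; rewrite trmx_eq0 => /(_ v0).
rewrite dot_mulmx -trmx_mul vM trmx0 /dot big1 ?ltxx // => j _.
by rewrite mxE mul0r.
Qed.

(** * Restriction to a coordinate subspace *)

Section Submatrix.
Context {R : realType} {p : nat} (A : {set 'I_p}).

(** The matrix of the inclusion of the coordinate subspace; its transpose is the restriction. It
    turns [sub_vec] and [sub_mat] into matrix products. *)
Definition incl_mx : 'M[R]_(p, #|A|) := \matrix_(j, k) (j == enum_val k)%:R.

Lemma incl_trE (n : nat) (M : 'M[R]_(p, n)) k l :
  (incl_mx^T *m M) k l = M (enum_val k) l.
Proof.
rewrite mxE (bigD1 (enum_val k)) //= !mxE eqxx mul1r big1 ?addr0 // => j jk.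
by rewrite !mxE (negbTE jk) mul0r.
Qed.

Lemma sub_vecE (v : 'cV[R]_p) : sub_vec A v = incl_mx^T *m v.
Proof. by apply/matrixP => k l; rewrite ord1 incl_trE mxE. Qed.

Lemma sub_matE (K : 'M[R]_p) : sub_mat A K = incl_mx^T *m (K *m incl_mx).
Proof.
apply/matrixP => k l; rewrite incl_trE !mxE.
rewrite (bigD1 (enum_val l)) //= !mxE eqxx mulr1 big1 ?addr0 // => j jl.
by rewrite !mxE (negbTE jl) mulr0.
Qed.

Lemma incl_trK : incl_mx^T *m incl_mx = 1%:M.
Proof.
apply/matrixP => k l; rewrite incl_trE !mxE.
by rewrite (inj_eq enum_val_inj).
Qed.

Lemma inclK (v : 'cV[R]_p) :
  (forall j, j \notin A -> v j 0 = 0) -> incl_mx *m (incl_mx^T *m v) = v.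
Proof.
move=> supp; apply/matrixP => j l; rewrite ord1 mxE.
under eq_bigr do rewrite incl_trE mxE.
rewrite -(big_enum_val (A := [in A]) (fun i => (j == i)%:R * v i 0)) /=.
have [jA|jA] := boolP (j \in A).
  rewrite (bigD1 j) //= eqxx mul1r big1 ?addr0 // => i /andP[_ ij].
  by rewrite eq_sym (negbTE ij) mul0r.
rewrite supp // big1 // => i iA; case: eqVneq => [ji|]; rewrite ?mul0r //.
by rewrite ji iA in jA.
Qed.

(** The quadratic form of the submatrix is that of [K] on vectors extended by zero, hence positive
    definite. *)
Lemma sub_mat_unit (K : 'M[R]_p) :
  (forall v : 'cV[R]_p, v != 0 -> 0 < dot v (K *m v)) -> sub_mat A K \in unitmx.
Proof.
move=> pd; apply: unitmx_pd => v v0.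
rewrite sub_matE -!mulmxA dot_mulmx trmxK; apply: pd.
by apply: contra_neq v0 => Sv; rewrite -[v]mul1mx -incl_trK -mulmxA Sv mulmx0.
Qed.

End Submatrix.

(** The ray parameter is [- lam]: on the support of [s] the residual equation reads
    [K_A beta_A = b_A - lam s_A]. *)
Lemma kkt_lasso_ray (R : realType) (p : nat) (K : 'M[R]_p)
    (b s beta : 'cV[R]_p) (t lam : R) :
  (forall v : 'cV[R]_p, v != 0 -> 0 < dot v (K *m v)) -> kkt K b s beta t lam ->
  let A := finset (fun j => s j 0 != 0) in
  lasso_ray (sub_mat A K) (sub_vec A b) (sub_vec A s) (sub_vec A beta).
Proof.
move=> pd kb A; exists (- lam); first by rewrite oppr_le0 (kkt_ge0 kb).
have uA := sub_mat_unit A pd.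
rewrite scalemxAr -mulmxDr; apply: (canRL (mulKmx uA)).
have supp j : j \notin A -> beta j 0 = 0.
  by rewrite inE negbK => /eqP; exact: (kkt_supp kb).
rewrite sub_matE sub_vecE -!mulmxA inclK //.
apply/matrixP => k l; rewrite ord1 incl_trE.
have := enum_valP k; rewrite inE => /(kkt_eq kb); rewrite !mxE mulNr => <-.
by ring.
Qed.

(** Sign vectors encoded in a finite type, as [fibre_partition] requires. *)
Definition sign_code (R : realType) (p : nat) (v : 'cV[R]_p) :
    {ffun 'I_p -> bool * bool} :=
  [ffun j => (0 < v j 0, v j 0 < 0)].

Lemma sign_codeP (R : realType) (p : nat) (u v : 'cV[R]_p) :
  sign_code u = sign_code v <-> sign_vector u = sign_vector v.
Proof.
split=> [/ffunP h|/matrixP h].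
  apply/matrixP => j i; rewrite ord1 !mxE; move: (h j); rewrite !ffunE.
  case: (ltrgt0P (u j 0)) => [uj|uj|->];
    case: (ltrgt0P (v j 0)) => [vj|vj|->] //.
    by rewrite !gtr0_sg.
  by rewrite !ltr0_sg.
apply/ffunP => j; have := h j 0; rewrite !mxE !ffunE => sg_uv.
by rewrite -sgr_gt0 -sgr_lt0 sg_uv sgr_gt0 sgr_lt0.
Qed.

Lemma sign_vectorK (R : realType) (p : nat) (v : 'cV[R]_p) :
  sign_vector (sign_vector v) = sign_vector v.
Proof. by apply/matrixP => i j; rewrite !mxE sgr_id. Qed.

Lemma sign_vector_convex (R : realType) (p : nat) (u v : 'cV[R]_p) (a : R) :
  0 <= a <= 1 -> sign_vector u = sign_vector v ->
  sign_vector ((1 - a) *: u + a *: v) = sign_vector u.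
Proof.
move=> a01 /matrixP uv; apply/matrixP => j i; rewrite ord1 !mxE.
have := uv j 0; rewrite !mxE; move: (u j 0) (v j 0) => r r'.
case: (ltrgt0P r) => [r0|r0|->]; last 1 first.
- rewrite sgr0 mulr0 add0r => /esym/eqP; rewrite sgr_eq0 => /eqP ->.
  by rewrite mulr0 sgr0.
- rewrite (gtr0_sg r0) => /esym/eqP; rewrite sgr_cp0 => r0'.
  by apply/eqP; rewrite sgr_cp0; nra.
- rewrite (ltr0_sg r0) => /esym/eqP; rewrite sgr_cp0 => r0'.
  by apply/eqP; rewrite sgr_cp0; nra.
Qed.

(** * The solution path *)

Section KktPath.
Context {R : realType} {p : nat} (K : 'M[R]_p) (b : 'cV[R]_p).
Hypothesis K_sym : K^T = K.
Hypothesis K_pd : forall v : 'cV[R]_p, v != 0 -> 0 < dot v (K *m v).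
Context (c : R -> 'cV[R]_p) (T : R).
Hypothesis c_kkt : forall t : R, 0 <= t <= T ->
  exists lam, kkt K b (sign_vector (c t)) (c t) t lam.

Lemma kkt_path_eq (s beta : 'cV[R]_p) (t lam : R) :
  0 <= t <= T -> sign_vector s = s -> kkt K b s beta t lam -> c t = beta.
Proof.
move=> /c_kkt[mu ct] ss kb.
exact: (kkt_unique K_sym K_pd (sign_vectorK _) ss ct kb).
Qed.

(** The parameter can be read off the point, which makes the path injective. *)
Lemma path_l1norm (t : R) : 0 <= t <= T -> l1norm (c t) = t.
Proof. by move=> /c_kkt[lam /kkt_l1norm->] //; exact: sign_vectorK. Qed.

Lemma path_face_direction (s t : R) :
  0 <= s <= T -> 0 <= t <= T -> s < t ->
  sign_vector (c s) = sign_vector (c t) ->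
  exists w mu, face_direction K (sign_vector (c s)) w mu /\
               c t = c s + (t - s) *: w.
Proof.
move=> /c_kkt[lam ks] /c_kkt[lam' kt] st sg_st; rewrite -sg_st in kt.
have st' : s != t by rewrite lt_eqF.
by have [w [mu [fd cE _]]] := kkt_direction ks kt st'; exists w, mu.
Qed.

(** The convex combination of the points at [s] and [t] satisfies the conditions at [u], so by
    uniqueness it is [c u]. *)
Lemma path_sign_convex (s u t : R) : 0 <= s -> s <= u -> u <= t -> t <= T ->
  sign_vector (c s) = sign_vector (c t) ->
  sign_vector (c u) = sign_vector (c s).
Proof.
move=> s0 su ut tT sg_st.
have [su_eq|su_neq] := eqVneq s u; first by rewrite su_eq.
have su' : s < u by rewrite lt_neqAle su_neq.
pose a := (u - s) / (t - s).
have ts0 : t - s != 0 by rewrite gt_eqF //; lra.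
have a01 : 0 <= a <= 1.
  by rewrite divr_ge0 ?ler_pdivrMr ?mul1r //; lra.
have uE : u = (1 - a) * s + a * t by rewrite /a; field.
have hs : 0 <= s <= T by lra.
have ht : 0 <= t <= T by lra.
have hu : 0 <= u <= T by lra.
have [lam ks] := c_kkt hs; have [lam' kt] := c_kkt ht; rewrite -sg_st in kt.
have := kkt_convex ks kt a01; rewrite -uE => ku.
rewrite (kkt_path_eq hu (sign_vectorK _) ku).
exact: sign_vector_convex.
Qed.

(** In the open interval all points share one face direction. At the end points the sign vector may
    change, but the closed conditions persist and uniqueness still identifies [c]. *)
Lemma path_affine_on (e e' : R) : 0 <= e -> e < e' -> e' <= T ->
  (forall s t : R, e < s < e' -> e < t < e' ->
    sign_vector (c s) = sign_vector (c t)) ->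
  affine_on c `[e, e'].
Proof.
move=> e0 ee eT sg.
pose m := (e + e') / 2; pose m' := (m + e') / 2.
have me : e < m < e' by rewrite /m; lra.
have me' : e < m' < e' by rewrite /m' /m; lra.
have mm' : m != m' by rewrite lt_eqF // /m' /m; lra.
have inT t : e <= t <= e' -> 0 <= t <= T by lra.
have [lam km] : exists lam, kkt K b (sign_vector (c m)) (c m) m lam.
  by apply/c_kkt/inT; lra.
have sgm t : e < t < e' ->
    exists lam, kkt K b (sign_vector (c m)) (c t) t lam.
  by move=> et; rewrite (sg m t) //; apply/c_kkt/inT; lra.
have [lam' km'] := sgm m' me'.
have [w [mu [fd _ _]]] := kkt_direction km km' mm'.
have kt t : e < t < e' -> kkt K b (sign_vector (c m))
    (c m + (t - m) *: w) t (lam - (t - m) * mu).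
  move=> et; have [<-|mt] := eqVneq m t.
    by rewrite subrr scale0r addr0 mul0r subr0.
  have [lamt ktt] := sgm t et.
  have [w' [mu' [fd' cE lamE]]] := kkt_direction km ktt mt.
  have [-> ->] := face_direction_unique K_pd fd fd'.
  by rewrite -cE -lamE.
have cE t : e <= t <= e' -> c t = c m + (t - m) *: w.
  move=> et; apply: (kkt_path_eq (inT _ et) (sign_vectorK _)).
  exact: (kkt_closure ee kt et).
move=> s t u /=; rewrite !in_itv /= => es et u01.
rewrite (cE s es) (cE t et) cE; last by nra.
by apply/matrixP => i j; rewrite !mxE; ring.
Qed.

Lemma path_parallel (s s' t t' : R) (d : 'cV[R]_p) :
  0 <= s <= T -> 0 <= s' <= T -> s < s' ->
  sign_vector (c s) = sign_vector (c s') ->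
  0 <= t <= T -> 0 <= t' <= T -> t < t' ->
  sign_vector (c t) = sign_vector (c t') ->
  (exists a : R, c s' - c s = a *: d) -> (exists a : R, c t' - c t = a *: d) ->
  sign_vector (c s) = sign_vector (c t).
Proof.
move=> hs hs' ss sg_s ht ht' tt sg_t [a aE] [a' aE'].
have [w [mu [fd wE]]] := path_face_direction hs hs' ss sg_s.
have [w' [mu' [fd' wE']]] := path_face_direction ht ht' tt sg_t.
move: aE aE'; rewrite wE wE' ![c _ + _]addrC !addrK => aE aE'.
have ss0 : s' - s != 0 by rewrite subr_eq0 gt_eqF.
have tt0 : t' - t != 0 by rewrite subr_eq0 gt_eqF.
have a0 : a != 0.
  apply: contra_neq (face_direction_neq0 fd) => a0.
  by apply: (scalerI ss0); rewrite aE a0 scale0r scaler0.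
have w'E : w' = ((t' - t)^-1 * a' * a^-1 * (s' - s)) *: w.
  apply: (scalerI tt0); rewrite aE' -2!scalerA aE !scalerA.
  by congr (_ *: _); field; rewrite a0 tt0.
(* The later parameters [s'] and [t'] are used because [parallel_faces] needs a positive one. *)
have [lam ks] := c_kkt hs'; have [lam' kt] := c_kkt ht'.
rewrite sg_s in fd *; rewrite sg_t in fd' *.
apply: (parallel_faces K_sym K_pd erefl erefl ks kt _ _ fd fd' w'E); lra.
Qed.

End KktPath.

(** * The lasso path of a full rank data set and its segments *)

Section Lasso.
Context {R : realType} {p N : nat} (x : 'I_N -> 'cV[R]_p) (y : 'I_N -> R).
Hypothesis p_gt0 : (0 < p)%N.
Hypothesis hrank : full_rank_data x y.

Let K_sym := gram_sym x.
Let K_pd := gram_pd hrank.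

Lemma gram_unit : gram x \in unitmx.
Proof. exact: unitmx_pd K_pd. Qed.

Lemma data_nonempty : N != 0%N.
Proof.
have v0 : delta_mx (Ordinal p_gt0) 0 != 0 :> 'cV[R]_p.
  apply/eqP => /matrixP/(_ (Ordinal p_gt0) 0)/eqP.
  by rewrite !mxE !eqxx oner_eq0.
have [i _] := full_rank_dot hrank v0.
by rewrite -lt0n (leq_ltn_trans _ (ltn_ord i)).
Qed.

(** [xget] can only return [beta]: a second unique minimizer would give strict inequalities both
    ways. *)
Lemma kkt_lasso (s beta : 'cV[R]_p) (t lam : R) :
  sign_vector s = s -> kkt (gram x) (covec x y) s beta t lam ->
  lasso x y t = beta.
Proof.
move=> ss kb; have betat := kkt_l1norm ss kb.
have N0 : 0 < N%:R :> R by rewrite ltr0n lt0n data_nonempty.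
have best gamma : l1norm gamma <= t -> gamma <> beta ->
    lasso_objective x y beta < lasso_objective x y gamma.
  move=> gt /eqP gb; rewrite !lasso_objectiveE ?data_nonempty //.
  rewrite ltrD2r ltr_pM2l; last by rewrite divr_gt0.
  exact: (kkt_phi_lt K_sym K_pd kb).
apply: xget_unique => [|gamma [gt gbest]]; first by split; rewrite ?betat.
apply: contrapT => gb; have bg := best _ gt gb.
have gb' : lasso_objective x y gamma < lasso_objective x y beta.
  by apply: gbest; [rewrite betat|move=> /esym].
by have := lt_trans bg gb'; rewrite ltxx.
Qed.

(** If the minimizer has zero residual, it is [beta_hat], whose l1 norm [t_hat] is at least [t]; so
    [minimizer_kkt] applies. *)
Lemma lasso_kkt (t : R) : 0 <= t <= t_hat x y ->
  exists lam, kkt (gram x) (covec x y) (sign_vector (lasso x y t))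
                (lasso x y t) t lam.
Proof.
move=> /andP[t0 tT].
have [beta bt bmin] := exists_minimizer (gram x) (covec x y) t0.
have [|lam kb] := minimizer_kkt K_sym t0 bt bmin.
  move=> bE; have <- : beta_hat x y = beta; last exact: tT.
  by rewrite /beta_hat -bE mulKmx // gram_unit.
by exists lam; rewrite (kkt_lasso (sign_vectorK _) kb).
Qed.

(** [beta_hat] has zero residual and satisfies the conditions with multiplier 0. *)
Lemma lasso_t_hat : lasso x y (t_hat x y) = beta_hat x y.
Proof.
have resid0 : covec x y - gram x *m beta_hat x y = 0.
  by rewrite /beta_hat mulKVmx ?subrr ?gram_unit.
apply: (@kkt_lasso (sign_vector (beta_hat x y)) _ _ 0).
  exact: sign_vectorK.
split=> // [j|j _|j|j|].
- by rewrite resid0 mxE normr0.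
- by rewrite resid0 mxE mul0r.
- by rewrite mxE => /eqP; rewrite sgr_eq0 => /eqP.
- by rewrite mxE -normrEsg.
- exact: dot_sign_vector.
Qed.

Lemma t_hat_ge0 : 0 <= t_hat x y. Proof. exact: l1norm_ge0. Qed.

Lemma lasso0 : lasso x y 0 = 0.
Proof.
apply: l1norm_eq0; rewrite (path_l1norm lasso_kkt) //.
by rewrite lexx t_hat_ge0.
Qed.

Definition sign_fibre (t : R) : set R :=
  [set u | 0 <= u <= t_hat x y /\
           sign_vector (lasso x y u) = sign_vector (lasso x y t)].

Lemma sign_fibre_portion (t : R) : sign_constant_portion x y (sign_fibre t).
Proof.
split=> [u v [uT ut] [vT vt] w uwv|u [uT _]|u v [_ ->] [_ ->]] //.
split; first lra.
rewrite -ut; apply: (path_sign_convex K_sym K_pd lasso_kkt (t := v)).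
- lra.
- lra.
- lra.
- lra.
- by rewrite vt.
Qed.

Lemma segment_in (I : set R) (t : R) :
  lasso_segment x y I -> I t -> 0 <= t <= t_hat x y.
Proof. by move=> [[_ IT _] _ _] /IT; rewrite /= in_itv. Qed.

Lemma segment_sign (I : set R) (s t : R) : lasso_segment x y I ->
  I s -> I t -> sign_vector (lasso x y s) = sign_vector (lasso x y t).
Proof. by move=> [[_ _ sg] _ _]; exact: sg. Qed.

(** The fibre is itself a sign-constant portion containing [I], so maximality applies. *)
Lemma segment_fibre (I : set R) (t : R) :
  lasso_segment x y I -> I t -> I = sign_fibre t.
Proof.
move=> Iseg It; have [_ _ Imax] := Iseg; apply/esym/Imax.
  exact: sign_fibre_portion.
move=> u Iu; split; first exact: segment_in Iseg Iu.
exact: segment_sign Iseg Iu It.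
Qed.

Lemma fibre_segment (s t : R) : sign_fibre t s -> s < t ->
  0 <= t <= t_hat x y -> lasso_segment x y (sign_fibre t).
Proof.
move=> fs st tT; split; first exact: sign_fibre_portion.
  by exists s, t; split.
move=> J [_ JT sgJ] tJ; apply/seteqP; split=> // u Ju.
split; first by have := JT _ Ju; rewrite /= in_itv.
by apply: sgJ => //; apply: tJ; split.
Qed.

Lemma segment_ray (I : set R) : lasso_segment x y I ->
  exists (A : {set 'I_p}) (d : 'cV[R]_#|A|),
    [/\ A != finset.set0, forall k, d k 0 = 1 \/ d k 0 = -1 &
        lasso x y @` I `<=` induced_lasso_ray x y d].
Proof.
move=> Iseg; have [_ [s [t [Is It st]]] _] := Iseg.
pose sg := sign_vector (lasso x y t).
exists (finset (fun j => sg j 0 != 0)), (sub_vec _ sg); split.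
(* Positive length gives [t > 0], whereas an empty support would force [t = 0]. *)
- apply/eqP => /setP A0; have tT := segment_in Iseg It.
  have t0 : 0 < t by have := segment_in Iseg Is; lra.
  have [lam /kkt_dot] := lasso_kkt tT; rewrite -/sg /dot big1 => [t0'|j _].
    by move: t0; rewrite -t0' ltxx.
  by have := A0 j; rewrite !inE => /negPn/eqP ->; rewrite mul0r.
- move=> k; have := enum_valP k; rewrite mxE inE /sg mxE sgr_eq0.
  by move=> ck; case: sgrP ck => //; [left|right].
- move=> _ [u Iu <-]; have [lam ku] := lasso_kkt (segment_in Iseg Iu).
  rewrite (segment_sign Iseg Iu It) -/sg in ku.
  split; first exact: (kkt_lasso_ray K_pd ku).
  by move=> j; rewrite inE negbK => /eqP; exact: (kkt_supp ku).
Qed.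

Lemma segments_not_parallel (I J : set R) :
  lasso_segment x y I -> lasso_segment x y J -> I <> J ->
  ~ parallel (lasso x y @` I) (lasso x y @` J).
Proof.
move=> Iseg Jseg IJ [d [d0 Id Jd]]; apply: IJ.
have [_ [s [s' [Is Is' ss]]] _] := Iseg.
have [_ [t [t' [Jt Jt' tt]]] _] := Jseg.
have sg_st : sign_vector (lasso x y s) = sign_vector (lasso x y t).
  apply: (@path_parallel _ _ _ _ K_sym K_pd _ _ lasso_kkt s s' t t' d) => //.
  - exact: segment_in Iseg Is.
  - exact: segment_in Iseg Is'.
  - exact: segment_sign Iseg Is Is'.
  - exact: segment_in Jseg Jt.
  - exact: segment_in Jseg Jt'.
  - exact: segment_sign Jseg Jt Jt'.
  - by apply: Id; [exists s|exists s'].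
  - by apply: Jd; [exists t|exists t'].
rewrite (segment_fibre Iseg Is) (segment_fibre Jseg Jt).
by apply/seteqP; split=> u [uT ut]; split=> //; rewrite ut.
Qed.

End Lasso.

(** Allows segments to be open, half-open or closed. A point is approximated from the side of the
    midpoint, by a shift small against both the ball and the interval. *)
Lemma closure_between (R : realType) (e e' : R) (I : set R) :
  e < e' -> `]e, e'[ `<=` I -> I `<=` `[e, e'] -> closure I = `[e, e']%classic.
Proof.
move=> ee oI Ic; apply/seteqP; split.
  apply: subset_trans (closure_subset Ic) _.
  by rewrite -(closure_id _).1 //; exact: itv_closed.
apply: subset_trans (closure_subset oI) => t /=; rewrite in_itv /= => et B.
move=> /nbhs_ballP[r /= r0 rB].
have [et'|te'] := leP t ((e + e') / 2).
  pose h := Num.min (r / 2) ((e' - e) / 4).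
  have h0 : 0 < h by rewrite lt_min; lra.
  have [h1 h2] : h <= r / 2 /\ h <= (e' - e) / 4 by rewrite !ge_min !lexx orbT.
  exists (t + h); split; first by rewrite /= in_itv /=; lra.
  by apply: rB; rewrite /ball /= opprD addrA subrr sub0r normrN gtr0_norm; lra.
pose h := Num.min (r / 2) ((e' - e) / 4).
have h0 : 0 < h by rewrite lt_min; lra.
have [h1 h2] : h <= r / 2 /\ h <= (e' - e) / 4 by rewrite !ge_min !lexx orbT.
exists (t - h); split; first by rewrite /= in_itv /=; lra.
by apply: rB; rewrite /ball /= opprB addrC subrK gtr0_norm; lra.
Qed.

(** * Assembly of the polygonal chain *)

Theorem theorem3p6 (R : realType) (p N : nat) (hp : (2 <= p)%N)
    (x : 'I_N -> 'cV[R]_p) (y : 'I_N -> R)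
    (hcentroid : centroid x y = 0) (hrank : full_rank_data x y) :
  [/\ exists ts : seq R,
        [/\ simple_polygonal_chain (lasso x y) 0 (t_hat x y) ts,
            lasso x y 0 = 0,
            lasso x y (t_hat x y) = beta_hat x y &
            [set closure I | I in lasso_segment x y] = chain_pieces 0 ts],
      forall I J : set R, lasso_segment x y I -> lasso_segment x y J ->
        I <> J -> ~ parallel (lasso x y @` I) (lasso x y @` J) &
      forall I : set R, lasso_segment x y I ->
        exists (A : {set 'I_p}) (d : 'cV[R]_#|A|),
          [/\ A != finset.set0,
              forall k, d k 0 = 1 \/ d k 0 = -1 &
              lasso x y @` I `<=` induced_lasso_ray x y d]].
Proof.
have p0 : (0 < p)%N by exact: ltnW.
have K_sym := gram_sym x; have K_pd := gram_pd hrank.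
have T0 := t_hat_ge0 x y.
have path_kkt := @lasso_kkt _ _ _ x y p0 hrank.
split; last 2 first.
- exact: segments_not_parallel p0 hrank.
- exact: segment_ray p0 hrank.
have [|ts [ats lts tsP]] :=
    @fibre_partition R _ (fun t => sign_code (lasso x y t)) 0 (t_hat x y) T0.
  move=> s u t s0 su ut tT /sign_codeP st; apply/sign_codeP.
  exact: (path_sign_convex K_sym K_pd path_kkt s0 su ut tT st).
have srt : sorted <%R (0 :: ts) by [].
have piece k : (k < size ts)%N ->
    [/\ 0 <= (0 :: ts)`_k, (0 :: ts)`_k < ts`_k & ts`_k <= t_hat x y].
  move=> kts; have le i j : (i <= j <= size ts)%N ->
      (0 :: ts)`_i <= (0 :: ts)`_j.
    move=> /andP[ij jts]; rewrite (lt_sorted_leq_nth 0 srt) ?inE /= ?ltnS //.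
    exact: leq_trans jts.
  split.
  - by apply: (le 0%N); rewrite /= ltnW.
  - rewrite -[ts`_k]/((0 :: ts)`_k.+1).
    by rewrite (lt_sorted_ltn_nth 0 srt) ?inE //= ltnS // ltnW.
  - rewrite -lts (last_nth 0) -[ts`_k]/((0 :: ts)`_k.+1).
    by apply: le; rewrite kts leqnn.
pose inside k (t : R) := (0 :: ts)`_k < t < ts`_k.
have inT k t : (k < size ts)%N -> inside k t -> 0 <= t <= t_hat x y.
  by move=> /piece[? ? ?]; rewrite /inside; lra.
have insideE k s t : (k < size ts)%N -> inside k s -> inside k t ->
    sign_vector (lasso x y t) = sign_vector (lasso x y s).
  move=> kts ks kt; apply/sign_codeP.
  by apply: (tsP k s t kts ks (inT _ _ kts kt)).1.
have insideP k s t : (k < size ts)%N -> inside k s -> 0 <= t <= t_hat x y ->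
    sign_vector (lasso x y t) = sign_vector (lasso x y s) ->
    (0 :: ts)`_k <= t <= ts`_k.
  by move=> kts ks tT /sign_codeP; exact: (tsP k s t kts ks tT).2.
(* The fibre contains the open piece and stays in the closed one; whether it contains the end points
   is left open. *)
have closureE k t : (k < size ts)%N -> inside k t ->
    closure (sign_fibre x y t) = `[(0 :: ts)`_k, ts`_k]%classic.
  move=> kts kt; have [k0 kk kT] := piece k kts.
  apply: closure_between => // [u|u [uT ut]]; rewrite /= in_itv /=.
    by move=> ku; split; [exact: inT ku|exact: insideE ku].
  exact: insideP ut.
exists ts; split; [|exact: lasso0|exact: lasso_t_hat|].
  split=> // [I [k kts <-]|s t].
    have [k0 kk kT] := piece k kts.
    apply: (path_affine_on K_sym K_pd path_kkt) => // s t ks kt.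
    exact: (insideE k).
  rewrite !in_itv /= => sT tT st.
  by rewrite -(path_l1norm path_kkt sT) st (path_l1norm path_kkt tT).
apply/seteqP; split=> [_ [I Iseg <-]|_ [k kts <-]].
  have [_ [s [t [Is It st]]] _] := Iseg.
  have sT := segment_in Iseg Is; have tT := segment_in Iseg It.
  have [|k kts kt] := @path_cover _ 0 ts t; first by rewrite lts; lra.
  (* This point lies between [s] and [t], hence in the segment, and between the left node and [t],
     hence inside the piece. *)
  pose u := (Num.max s (0 :: ts)`_k + t) / 2.
  have [mx_s mx_k] : s <= Num.max s (0 :: ts)`_k /\
      (0 :: ts)`_k <= Num.max s (0 :: ts)`_k.
    by rewrite !le_max !lexx orbT.
  have mx_t : Num.max s (0 :: ts)`_k < t by rewrite gt_max st; case/andP: kt.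
  have ku : inside k u by rewrite /inside /u; lra.
  have Iu : I u.
    by have [[Iitv _ _] _ _] := Iseg; apply: (Iitv s t) => //; rewrite /u; lra.
  exists k => //.
  by rewrite (segment_fibre p0 hrank Iseg Iu) (closureE k u kts ku).
have [k0 kk kT] := piece k kts.
(* Two interior points [u' < u] of the piece show that its fibre has positive length. *)
pose u := ((0 :: ts)`_k + ts`_k) / 2; pose u' := ((0 :: ts)`_k + u) / 2.
have ku : inside k u by rewrite /inside /u; lra.
have ku' : inside k u' by rewrite /inside /u' /u; lra.
exists (sign_fibre x y u); last exact: closureE.
apply: (@fibre_segment _ _ _ x y p0 hrank u' u).
- by split; [exact: inT ku'|exact: insideE ku ku'].
- by rewrite /u' /u; lra.
- exact: inT ku.
Qed.
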